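(* Let $r_1,\ldots,r_m\in\mathbb{R}^m$ be affinely independent and let $F_r^2:\mathbb{R}^m\to\mathbb{R}^m$ be given by $F_r^2(x)=(\|x-r_1\|^2,\ldots,\|x-r_m\|^2)$. Let $H^-$ and $H^+$ be the two open halfspaces delimited by the affine hyperplane $H^0=\operatorname{Aff}(r_1,\ldots,r_m)$. Then: (i) the image $F_r^2(\mathbb{R}^m)$ is a solid paraboloid of $\mathbb{R}^m$; (ii) if $B$ is a ball contained in $H^-$ or in $H^+$, then $F_r^2(B)$ is a solid ellipsoid; (iii) consequently, if $B_1$ and $B_2$ are two disjoint balls that are both contained in the same one of the two halfspaces $H^-$, $H^+$, then $F_r^2(B_1)$ and $F_r^2(B_2)$ are separable by a hyperplane of $\mathbb{R}^m$.
   Context: $\mathbb{R}^m$ carries the standard Euclidean norm $\|\cdot\|$; $\operatorname{Aff}$ is the affine hull; balls are Euclidean balls of positive radius. A solid paraboloid of $\mathbb{R}^m$ (the region inside a paraboloid, boundary included) is the image of $\{(y,t)\in\mathbb{R}^{m-1}\times\mathbb{R}:\|y\|^2\le t\}$ under an invertible affine map of $\mathbb{R}^m$. A solid ellipsoid is the image of a ball of $\mathbb{R}^m$ (closed or open, according to whether $B$ is closed or open) under an invertible affine map of $\mathbb{R}^m$. Two sets $S_1,S_2\subset\mathbb{R}^m$ are separable by a hyperplane if there exist $w\in\mathbb{R}^m\setminus\{0\}$ and $c\in\mathbb{R}$ with $\langle w,y\rangle\le c$ for all $y\in S_1$ and $\langle w,y\rangle\ge c$ for all $y\in S_2$. *)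

(* Defs.v *)
From mathcomp Require Import all_boot all_order all_algebra.
From mathcomp Require Import classical_sets reals.

Set Implicit Arguments.
Unset Strict Implicit.
Unset Printing Implicit Defensive.

Import Order.TTheory GRing.Theory Num.Theory.
Local Open Scope classical_set_scope.
Local Open Scope ring_scope.

(* MathComp-Analysis equips 'rV[R]_m with the sup norm and the library's dot
   product lives over closed fields, hence the Euclidean ones defined here. *)
Definition dotr (R : realType) (m : nat) (x y : 'rV[R]_m) : R :=
  \sum_(i < m) x 0 i * y 0 i.

Definition enorm (R : realType) (m : nat) (x : 'rV[R]_m) : R :=
  Num.sqrt (dotr x x).

Definition aff_hull (R : realType) (k m : nat) (r : 'I_k -> 'rV[R]_m) :
    set 'rV[R]_m :=
  [set x | exists c : 'I_k -> R,
     \sum_(i < k) c i = 1 /\ x = \sum_(i < k) c i *: r i].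

Definition aff_independent (R : realType) (k m : nat) (r : 'I_k -> 'rV[R]_m) :
    Prop :=
  forall c : 'I_k -> R,
    \sum_(i < k) c i = 0 -> \sum_(i < k) c i *: r i = 0 -> forall i, c i = 0.

Definition is_hyperplane (R : realType) (m : nat) (H : set 'rV[R]_m) : Prop :=
  exists (w : 'rV[R]_m) (c : R), w != 0 /\ H = [set x | dotr w x = c].

(* Replacing (w, c) by (- w, - c) exchanges Hm and Hp: which side is called
   "negative" is left open. *)
Definition delimits (R : realType) (m : nat) (H0 Hm Hp : set 'rV[R]_m) : Prop :=
  exists (w : 'rV[R]_m) (c : R),
    [/\ w != 0, H0 = [set x | dotr w x = c],
        Hm = [set x | dotr w x < c] & Hp = [set x | dotr w x > c]].

(* [cl] tells closed (true) from open (false) balls and ellipsoids. *)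
Definition is_ball (R : realType) (m : nat) (cl : bool) (B : set 'rV[R]_m) :
    Prop :=
  exists (a : 'rV[R]_m) (rho : R),
    0 < rho /\ B = [set x | enorm (x - a) < rho ?<= if cl].

Definition aff_equivalent (R : realType) (m : nat) (S T : set 'rV[R]_m) :
    Prop :=
  exists (A : 'M[R]_m) (b : 'rV[R]_m),
    A \in unitmx /\ T = [set x *m A + b | x in S].

Definition solid_ellipsoid (R : realType) (m : nat) (cl : bool)
    (S : set 'rV[R]_m) : Prop :=
  exists B : set 'rV[R]_m, is_ball cl B /\ aff_equivalent B S.

(* z : R^(n+1) is read as (y, t) with t its last coordinate and
   y = col' ord_max z the n others. *)
Definition std_paraboloid (R : realType) (n : nat) : set 'rV[R]_n.+1 :=
  [set z | enorm (col' ord_max z) ^+ 2 <= z 0 ord_max].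

Definition solid_paraboloid (R : realType) (n : nat) (S : set 'rV[R]_n.+1) :
    Prop :=
  aff_equivalent (@std_paraboloid R n) S.

Definition separable_by_hyperplane (R : realType) (m : nat)
    (S1 S2 : set 'rV[R]_m) : Prop :=
  exists (w : 'rV[R]_m) (c : R),
    [/\ w != 0, forall y, S1 y -> dotr w y <= c & forall y, S2 y -> c <= dotr w y].

Definition sqdist_map (R : realType) (k m : nat) (r : 'I_k -> 'rV[R]_m)
    (x : 'rV[R]_m) : 'rV[R]_k :=
  \row_(i < k) enorm (x - r i) ^+ 2.

(* Main.v *)
(* The differences of the coordinates of [F x = (|x - r i|^2)_i] are affine in
   [x] and determine its projection [y] on the hyperplane through the [r i]; up
   to an affine map, [F] sends a point at height [s] above [y] to
   [(y, |y|^2 + s^2)], whence the paraboloid.  A ball with center [a] off the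
   hyperplane goes to the image of a ball under the affine map whose
   linear part is [v |-> (2 <v, a - r i>)_i].  Hyperplanes of the target pull
   back to the spheres centered on the hyperplane through the [r i] and to the
   hyperplanes orthogonal to it, so two disjoint balls on one side are separated
   by such a sphere, centered where the line of their centers meets the
   hyperplane, or, if that line is parallel to it, by a hyperplane orthogonal to
   that line. *)
Require Import Defs.
From mathcomp Require Import all_boot all_order all_algebra.
From mathcomp Require Import classical_sets reals.
From mathcomp Require Import ring lra.

Set Implicit Arguments.
Unset Strict Implicit.
Unset Printing Implicit Defensive.

Import Order.TTheory GRing.Theory Num.Theory.
Local Open Scope classical_set_scope.
Local Open Scope ring_scope.

(** * The Euclidean inner product and norm *)

Lemma dotrC (R : realType) m (x y : 'rV[R]_m) : dotr x y = dotr y x.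
Proof. by apply: eq_bigr => i _; rewrite mulrC. Qed.

Lemma dotrDl (R : realType) m (x y z : 'rV[R]_m) :
  dotr (x + y) z = dotr x z + dotr y z.
Proof. by rewrite -big_split; apply: eq_bigr => i _; rewrite mxE mulrDl. Qed.

Lemma dotrZl (R : realType) m k (x z : 'rV[R]_m) :
  dotr (k *: x) z = k * dotr x z.
Proof. by rewrite mulr_sumr; apply: eq_bigr => i _; rewrite mxE mulrA. Qed.

Lemma dotrNl (R : realType) m (x z : 'rV[R]_m) : dotr (- x) z = - dotr x z.
Proof. by rewrite -scaleN1r dotrZl mulN1r. Qed.

Lemma dotrDr (R : realType) m (x y z : 'rV[R]_m) :
  dotr z (x + y) = dotr z x + dotr z y.
Proof. by rewrite dotrC dotrDl !(dotrC z). Qed.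

Lemma dotrZr (R : realType) m k (x z : 'rV[R]_m) :
  dotr z (k *: x) = k * dotr z x.
Proof. by rewrite dotrC dotrZl (dotrC z). Qed.

Lemma dotrNr (R : realType) m (x z : 'rV[R]_m) : dotr z (- x) = - dotr z x.
Proof. by rewrite dotrC dotrNl (dotrC z). Qed.

Lemma dotr0 (R : realType) m (z : 'rV[R]_m) : dotr z 0 = 0.
Proof. by rewrite -(scale0r 0) dotrZr mul0r. Qed.

Definition dotrE := (dotrDl, dotrDr, dotrNl, dotrNr, dotrZl, dotrZr).

Lemma dotr_sumr (R : realType) m k (g : 'I_k -> R) (r : 'I_k -> 'rV[R]_m) z :
  dotr z (\sum_i g i *: r i) = \sum_i g i * dotr z (r i).
Proof.
rewrite (big_morph (dotr z) (fun x y => dotrDr x y z) (dotr0 z)).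
by apply: eq_bigr => i _; rewrite dotrZr.
Qed.

Lemma dotr_mx (R : realType) m (x y : 'rV[R]_m) : dotr x y = (x *m y^T) 0 0.
Proof. by rewrite mxE; apply: eq_bigr => i _; rewrite mxE. Qed.

Lemma dotr_ge0 (R : realType) m (x : 'rV[R]_m) : 0 <= dotr x x.
Proof. by apply: sumr_ge0 => i _; rewrite -expr2 sqr_ge0. Qed.

Lemma dotr_eq0 (R : realType) m (x : 'rV[R]_m) : (dotr x x == 0) = (x == 0).
Proof.
apply/eqP/eqP => [x0|->]; last exact: dotr0.
apply/rowP => i; rewrite mxE; apply/eqP; rewrite -sqrf_eq0 expr2.
move/eqP: x0; rewrite psumr_eq0 => [/allP/(_ i)|j _]; last first.
  by rewrite -expr2 sqr_ge0.
by rewrite mem_index_enum => /(_ isT).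
Qed.

Lemma dotr_gt0 (R : realType) m (x : 'rV[R]_m) : (0 < dotr x x) = (x != 0).
Proof. by rewrite lt0r dotr_eq0 dotr_ge0 andbT. Qed.

Lemma cauchy_schwarz (R : realType) m (x y : 'rV[R]_m) :
  dotr x y ^+ 2 <= dotr x x * dotr y y.
Proof.
have [->|y0] := eqVneq y 0; first by rewrite !dotr0 mulr0 expr0n.
have y1 : 0 < dotr y y by rewrite dotr_gt0.
rewrite -subr_ge0 -(pmulr_rge0 _ y1).
apply: le_trans (dotr_ge0 (dotr y y *: x - dotr x y *: y)) _.
by rewrite le_eqVlt !dotrE (dotrC y x); apply/orP; left; apply/eqP; ring.
Qed.

Lemma enorm_ge0 (R : realType) m (x : 'rV[R]_m) : 0 <= enorm x.
Proof. exact: sqrtr_ge0. Qed.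

Lemma sqr_enorm (R : realType) m (x : 'rV[R]_m) : enorm x ^+ 2 = dotr x x.
Proof. by rewrite sqr_sqrtr // dotr_ge0. Qed.

Lemma enormZ (R : realType) m k (x : 'rV[R]_m) : enorm (k *: x) = `|k| * enorm x.
Proof.
by rewrite /enorm !dotrE mulrA -expr2 sqrtrM ?sqr_ge0 // sqrtr_sqr.
Qed.

Lemma enormN (R : realType) m (x : 'rV[R]_m) : enorm (- x) = enorm x.
Proof. by rewrite /enorm !dotrE opprK. Qed.

Lemma dotr_le_enorm (R : realType) m (x y : 'rV[R]_m) :
  dotr x y <= enorm x * enorm y.
Proof.
apply: le_trans (ler_norm _) _.
rewrite -(@ler_pXn2r _ 2) // ?nnegrE ?mulr_ge0 ?enorm_ge0 //.
by rewrite exprMn !sqr_enorm real_normK ?num_real // cauchy_schwarz.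
Qed.

Lemma ler_enormD (R : realType) m (x y : 'rV[R]_m) :
  enorm (x + y) <= enorm x + enorm y.
Proof.
rewrite -(@ler_pXn2r _ 2) // ?nnegrE ?addr_ge0 ?enorm_ge0 //.
rewrite sqrrD !sqr_enorm !dotrE (dotrC y x).
have := dotr_le_enorm x y; lra.
Qed.

Lemma enorm_lteif (R : realType) m (x : 'rV[R]_m) rho cl : 0 < rho ->
  (enorm x < rho ?<= if cl) = (dotr x x < rho ^+ 2 ?<= if cl).
Proof.
move=> rho0; rewrite -sqr_enorm; case: cl => /=.
  by rewrite ler_pXn2r // ?nnegrE ?enorm_ge0 // ltW.
by rewrite ltr_pXn2r // ?nnegrE ?enorm_ge0 // ltW.
Qed.

(** * The affine hull of the [r i] and the offsets [a - r i] *)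

Lemma aff_hull_vertex (R : realType) k m (r : 'I_k -> 'rV[R]_m) i :
  aff_hull r (r i).
Proof.
exists (fun j => (j == i)%:R); split.
  by rewrite (bigD1 i) //= eqxx big1 ?addr0 // => j /negbTE ->.
rewrite (bigD1 i) //= eqxx scale1r big1 ?addr0 // => j /negbTE ->.
by rewrite scale0r.
Qed.

Lemma sqdist_mapE (R : realType) k m (r : 'I_k -> 'rV[R]_m) x i :
  sqdist_map r x 0 i = dotr (x - r i) (x - r i).
Proof. by rewrite mxE sqr_enorm. Qed.

(** A linear form with weights [g] pulls back to a squared distance plus a constant if the weights
    sum to one, and to an affine function if they sum to zero. *)
Lemma dotr_sqdist_map (R : realType) k m (r : 'I_k -> 'rV[R]_m) g x :
  dotr (\row_i g i) (sqdist_map r x) =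
  (\sum_i g i) * dotr x x - 2 * dotr x (\sum_i g i *: r i)
    + \sum_i g i * dotr (r i) (r i).
Proof.
rewrite dotr_sumr mulr_suml mulr_sumr -sumrB -big_split /=.
apply: eq_bigr => i _; rewrite sqdist_mapE mxE !dotrE (dotrC (r i) x); ring.
Qed.

(** Twice this matrix is the derivative of [sqdist_map r] at [a], acting on row vectors. *)
Definition offset_mx (R : realType) k m (r : 'I_k -> 'rV[R]_m) (a : 'rV[R]_m) :
    'M[R]_(m, k) :=
  \matrix_(j, i) (a - r i) 0 j.

Lemma mul_offset_mx (R : realType) k m (r : 'I_k -> 'rV[R]_m) a v i :
  (v *m offset_mx r a) 0 i = dotr v (a - r i).
Proof. by rewrite mxE; apply: eq_bigr => j _; rewrite mxE. Qed.

Lemma mul_tr_offset_mx (R : realType) k m (r : 'I_k -> 'rV[R]_m) a (g : 'rV[R]_k) :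
  g *m (offset_mx r a)^T = (\sum_i g 0 i) *: a - \sum_i g 0 i *: r i.
Proof.
apply/rowP => j; rewrite !mxE summxE mulr_suml -sumrB.
by apply: eq_bigr => i _; rewrite !mxE mulrBr.
Qed.

(* A nontrivial relation between the [a - r i] would, paired with [w], have
   coefficients of sum zero, and hence be an affine relation between the [r i]. *)
Lemma offset_mx_unit (R : realType) m (r : 'I_m -> 'rV[R]_m) a w c :
    aff_independent r -> (forall i, dotr w (r i) = c) -> dotr w a != c ->
  offset_mx r a \in unitmx.
Proof.
move=> hr wr wa; rewrite -unitmx_tr -row_free_unit -kermx_eq0.
apply/rowV0P => g /sub_kermxP; rewrite mul_tr_offset_mx => g0.
have sg : \sum_i g 0 i = 0.
  have := congr1 (dotr w) g0; rewrite dotr0 !dotrE dotr_sumr.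
  under [X in _ - X]eq_bigr do rewrite wr.
  rewrite -mulr_suml -mulrBr => /eqP; rewrite mulf_eq0 subr_eq0 (negbTE wa) orbF.
  by move/eqP.
apply/rowP => i; rewrite mxE; apply: hr => //.
by move: g0; rewrite sg scale0r sub0r => /eqP; rewrite oppr_eq0 => /eqP.
Qed.

(** Based at [r 0], the offset matrix has a zero column, hence a nonzero row vector in its
    kernel. *)
Lemma exists_normal (R : realType) n (r : 'I_n.+1 -> 'rV[R]_n.+1) :
  exists2 w : 'rV[R]_n.+1, w != 0 & forall i, dotr w (r i) = dotr w (r 0).
Proof.
pose D := offset_mx r (r 0).
have : kermx D != 0.
  rewrite kermx_eq0 row_free_unit -unitmx_tr; apply: contraTN isT => Du.
  have := mulmxK Du (delta_mx (0 : 'I_1) 0).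
  rewrite -rowE (_ : row 0 _ = 0) ?mul0mx; last first.
    by apply/rowP => j; rewrite !mxE subrr.
  by move/rowP/(_ 0)/eqP; rewrite !mxE !eqxx eq_sym oner_eq0.
case/rowV0Pn => w /sub_kermxP wD w0; exists w => // i.
by move/rowP/(_ i): wD; rewrite mul_offset_mx mxE !dotrE => /eqP; rewrite subr_eq0 => /eqP.
Qed.

(** From right to left: the offsets from [r 0 + w] form a basis, in which [x - r 0] expands; pairing
    with [w] forces coefficients of sum zero, which correct the barycentric coordinates of [r 0]
    into those of [x]. *)
Lemma aff_hull_normal (R : realType) n (r : 'I_n.+1 -> 'rV[R]_n.+1) w c :
    aff_independent r -> w != 0 -> (forall i, dotr w (r i) = c) ->
  aff_hull r = [set x | dotr w x = c].
Proof.
move=> hr w0 wr; apply/seteqP; split => x /=.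
  case=> g [sg ->]; rewrite dotr_sumr.
  by under eq_bigr do rewrite wr; rewrite -mulr_suml sg mul1r.
move=> wx; pose a := r 0 + w.
have wa : dotr w a != c by rewrite !dotrE wr -subr_eq0 addrC addKr dotr_eq0.
have Mu := offset_mx_unit hr wr wa; rewrite -unitmx_tr in Mu.
pose g := (x - r 0) *m invmx (offset_mx r a)^T.
have xE : x - r 0 = (\sum_i g 0 i) *: a - \sum_i g 0 i *: r i.
  by rewrite -mul_tr_offset_mx mulmxKV.
have sg : \sum_i g 0 i = 0.
  have := congr1 (dotr w) xE; rewrite !dotrE dotr_sumr.
  under [X in _ = _ - X]eq_bigr do rewrite wr.
  rewrite -mulr_suml -mulrBr wx !wr subrr -[c + _ - c]addrAC subrr add0r => /esym/eqP.
  by rewrite mulf_eq0 dotr_eq0 (negbTE w0) orbF => /eqP.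
have [e [se re]] := aff_hull_vertex r 0.
exists (fun i => e i - g 0 i); rewrite sumrB sg subr0; split=> //.
under eq_bigr do rewrite scalerBl.
by rewrite sumrB -re -[x](subrK (r 0)) xE sg scale0r sub0r addrC.
Qed.

(** * The image of the whole space *)

Lemma dotr_normalize (R : realType) m (w : 'rV[R]_m) : w != 0 ->
  dotr ((enorm w)^-1 *: w) ((enorm w)^-1 *: w) = 1.
Proof.
move=> w0; have nw : 0 < enorm w by rewrite sqrtr_gt0 dotr_gt0.
by rewrite !dotrE -sqr_enorm; field; rewrite gt_eqF.
Qed.

(* The Householder reflection exchanging [w] and the last basis vector. *)
Lemma orthogonal_completion (R : realType) n (w : 'rV[R]_n.+1) :
    dotr w w = 1 ->
  exists2 H : 'M[R]_n.+1, H *m H^T = 1%:M & row ord_max H = w.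
Proof.
move=> ww; pose e : 'rV[R]_n.+1 := delta_mx 0 ord_max.
have dote x : dotr e x = x 0 ord_max.
  rewrite /dotr (bigD1 ord_max) //= big1 ?addr0 => [|j /negbTE jn].
    by rewrite mxE !eqxx mul1r.
  by rewrite mxE jn andbF mul0r.
have ee : dotr e e = 1 by rewrite dote mxE !eqxx.
have [ew|ne] := eqVneq e w.
  exists 1%:M; first by rewrite trmx1 mulmx1.
  by rewrite rowE mulmx1.
pose v := e - w; have v0 : 0 < dotr v v by rewrite dotr_gt0 subr_eq0.
pose k := 2 / dotr v v; pose V := v^T *m v.
have VV : V *m V = dotr v v *: V.
  rewrite /V mulmxA -[v^T *m v *m _]mulmxA [v *m _]mx11_scalar -dotr_mx.
  by rewrite mul_mx_scalar scalemxAl.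
have VT : V^T = V by rewrite trmx_mul trmxK.
exists (1%:M - k *: V).
  rewrite [(_ - _)^T]linearB /= [(k *: V)^T]linearZ /= VT trmx1.
  rewrite mulmxBl mul1mx mulmxBr mulmx1.
  rewrite -scalemxAl -scalemxAr VV !scalerA.
  rewrite (_ : k * k * dotr v v = k + k); last by rewrite /k; field; rewrite gt_eqF.
  by rewrite scalerDl opprB addrK subrK.
rewrite rowE mulmxBr mulmx1 -scalemxAr mulmxA [_ *m v^T]mx11_scalar -dotr_mx.
rewrite mul_scalar_mx scalerA (_ : k * dotr e v = 1) ?scale1r ?subKr //.
(* As [e] and [w] are unit vectors, [|e - w|^2 = 2 <e, v>], so the reflection sends [e] to
   [e - v = w]. *)
have vv : dotr v v = 2 * dotr e v.
  by rewrite /v !dotrE (dotrC w e) ee ww; ring.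
rewrite /k vv; field; apply: lt0r_neq0.
have : 0 < 2 * dotr e v by rewrite -vv.
lra.
Qed.

Lemma sqr_enorm_col' (R : realType) n (z : 'rV[R]_n.+1) i0 :
  enorm (col' i0 z) ^+ 2 = dotr z z - z 0 i0 ^+ 2.
Proof.
apply/eqP; rewrite sqr_enorm eq_sym subr_eq eq_sym; apply/eqP.
rewrite [RHS]/dotr (bigD1_ord i0) //= addrC; congr (_ + _); apply: eq_bigr => j _.
by rewrite !mxE.
Qed.

Lemma sqdist_map_shift (R : realType) k m (r : 'I_k -> 'rV[R]_m) a e i :
  sqdist_map r (a + e) 0 i =
  dotr e e + 2 * dotr e (a - r i) + dotr (a - r i) (a - r i).
Proof.
rewrite sqdist_mapE -addrA addrC -addrA (addrC _ a).
by move: (a - r i) => q; rewrite !dotrE (dotrC q e); ring.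
Qed.

(** With [y = z *m H], the last entry of [z] is the height of [y] along [w]. The point [r 0 + u]
    corresponds to the [y] that has the part of [u] orthogonal to [w] and height [|u|^2]; the
    paraboloid inequality then says that the squared height of [u] is nonnegative. *)
Lemma solid_paraboloid_sqdist_map (R : realType) n
    (r : 'I_n.+1 -> 'rV[R]_n.+1) w c :
    aff_independent r -> dotr w w = 1 -> (forall i, dotr w (r i) = c) ->
  solid_paraboloid (range (sqdist_map r)).
Proof.
move=> hr ww wr; have [H HH Hw] := orthogonal_completion ww.
(* The factor one half makes [2 <y, a - r i>] equal to [<y, w> + 2 <y, r 0 - r i>]. *)
pose a := r 0 + 2^-1 *: w.
have wa : dotr w a != c by rewrite !dotrE wr ww; apply/eqP; lra.
have w0 i : dotr w (r 0 - r i) = 0 by rewrite !dotrE !wr subrr.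
have dotH (x y : 'rV[R]_n.+1) : dotr (x *m H) (y *m H) = dotr x y.
  by rewrite !dotr_mx trmx_mul mulmxA -(mulmxA x) HH mulmx1.
have lastE (z : 'rV[R]_n.+1) : z 0 ord_max = dotr (z *m H) w.
  rewrite -Hw rowE dotH /dotr (bigD1 ord_max) //= big1 ?addr0 => [|j /negbTE jn].
    by rewrite mxE !eqxx mulr1.
  by rewrite mxE jn andbF mulr0.
have stdE (z : 'rV[R]_n.+1) : std_paraboloid z =
    (dotr (z *m H) (z *m H) - dotr (z *m H) w ^+ 2 <= dotr (z *m H) w) :> Prop.
  by rewrite /std_paraboloid /= sqr_enorm_col' lastE dotH.
pose A := 2 *: (H *m offset_mx r a).
pose b := \row_i dotr (r 0 - r i) (r 0 - r i).
have GE (z : 'rV[R]_n.+1) i : (z *m A + b) 0 i = dotr (z *m H) w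
    + 2 * dotr (z *m H) (r 0 - r i) + dotr (r 0 - r i) (r 0 - r i).
  rewrite mxE -scalemxAr mxE mulmxA mul_offset_mx [b 0 i]mxE.
  rewrite /a (addrAC (r 0)) (dotrDr (r 0 - r i)) dotrZr; congr (_ + _); by field.
exists A, b; split.
  rewrite unitmxZ ?unitfE ?pnatr_eq0 // unitmx_mul.
  by rewrite (offset_mx_unit hr wr wa) andbT; have [] := mulmx1_unit HH.
apply/seteqP; split => [_ [x _ <-]|_ [z + <-]] /=.
  have {x} [u ->] : exists u, x = r 0 + u by exists (x - r 0); rewrite addrC subrK.
  pose y := u + (dotr u u - dotr u w) *: w.
  have yw : dotr y w = dotr u u by rewrite !dotrE ww; ring.
  have zy : y *m H^T *m H = y by rewrite -mulmxA (mulmx1C HH) mulmx1.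
  exists (y *m H^T).
    rewrite stdE zy yw !dotrE (dotrC w u) ww -subr_ge0.
    rewrite [leRHS](_ : _ = dotr u w ^+ 2) ?sqr_ge0 //; ring.
  have yE i : dotr y (r 0 - r i) = dotr u (r 0 - r i).
    by rewrite [LHS]dotrDl dotrZl w0 mulr0 addr0.
  by apply/rowP => i; rewrite GE zy yw sqdist_map_shift yE.
rewrite stdE; move: (z *m H) (GE z) => y {}GE yP.
pose t := dotr y w.
(* The height [s] of a preimage must satisfy [|y|^2 - t^2 + s^2 = t], solvable by the paraboloid
   inequality. *)
pose s := Num.sqrt (t + t ^+ 2 - dotr y y).
have s2 : s ^+ 2 = t + t ^+ 2 - dotr y y.
  by rewrite sqr_sqrtr //; move: yP; rewrite -/t; lra.
pose u := y + (s - t) *: w.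
have uu : dotr u u = t.
  rewrite !dotrE ww (dotrC w y) -/t.
  rewrite [LHS](_ : _ = dotr y y + s ^+ 2 - t ^+ 2); last ring.
  by rewrite s2; ring.
exists (r 0 + u) => //; apply/rowP => i.
by rewrite GE sqdist_map_shift uu [dotr u _]dotrDl dotrZl w0 mulr0 addr0.
Qed.

(** * Images of balls on one side of the hyperplane *)

(* For [x = a + e], expanding [|x - r i|^2] leaves the quadratic term [|e|^2].
   As [dotr w (a - r i)] is the same for all [i], this term is absorbed by
   sliding [e] along [w] to [v = e - l *: w], which maps the ball to itself. *)
Lemma sqdist_map_ball (R : realType) k m (r : 'I_k -> 'rV[R]_m) w c a rho cl :
    dotr w w = 1 -> (forall i, dotr w (r i) = c) -> 0 < rho ->
    rho <= dotr w a - c ->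
  sqdist_map r @` [set x | enorm (x - a) < rho ?<= if cl] =
  [set v *m (2 *: offset_mx r a)
     + \row_i (dotr (a - r i) (a - r i) + rho ^+ 2)
   | v in [set v | enorm (v - 0) < rho ?<= if cl]].
Proof.
move=> ww wr rho0; set s := _ - c => rs.
have wq i : dotr w (a - r i) = s by rewrite !dotrE wr.
have s0 : 0 < s by apply: lt_le_trans rs.
have GE (v : 'rV[R]_m) i : (v *m (2 *: offset_mx r a)
     + \row_i (dotr (a - r i) (a - r i) + rho ^+ 2)) 0 i =
     2 * dotr v (a - r i) + dotr (a - r i) (a - r i) + rho ^+ 2.
  by rewrite mxE -scalemxAr mxE mul_offset_mx mxE addrA.
have match_ e v l i : v = e - l *: w -> 2 * s * l = rho ^+ 2 - dotr e e ->
    sqdist_map r (a + e) 0 i = (v *m (2 *: offset_mx r a)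
      + \row_i (dotr (a - r i) (a - r i) + rho ^+ 2)) 0 i.
  move=> -> ll; rewrite GE sqdist_map_shift; move: (a - r i) (wq i) => q {}wq.
  rewrite dotrDl dotrNl dotrZl wq.
  have -> : rho ^+ 2 = 2 * s * l + dotr e e by rewrite ll subrK.
  ring.
have wbound e : dotr w e ^+ 2 <= dotr e e.
  by have := cauchy_schwarz w e; rewrite ww mul1r.
apply/seteqP; split => [_ [x + <-]|_ [v + <-]] /=.
  have {x} [e ->] : exists e, x = a + e by exists (x - a); rewrite addrC subrK.
  rewrite /= [a + e - a]addrC addKr enorm_lteif // => eP.
  (* The slide [l] is forced by [match_]. In the factorization [vv] below, the sign of the second
     factor comes from [rho <= s] and [- rho <= d], which give [rho <= 2 * s + d]. *)
  pose l := (rho ^+ 2 - dotr e e) / (2 * s).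
  have ll : 2 * s * l = rho ^+ 2 - dotr e e by rewrite /l; field; rewrite gt_eqF.
  exists (e - l *: w); last first.
    by apply/rowP => i; rewrite -(match_ e _ l).
  rewrite subr0 enorm_lteif //.
  have := wbound e; set d := dotr w e => de.
  have vv : rho ^+ 2 - dotr (e - l *: w) (e - l *: w) = l * (2 * s + 2 * d - l).
    rewrite !dotrE ww (dotrC e w) -/d.
    have -> : rho ^+ 2 = 2 * s * l + dotr e e by rewrite ll subrK.
    ring.
  have PE : 2 * s * (2 * s + 2 * d - l)
      = (2 * s + d) ^+ 2 - rho ^+ 2 + (dotr e e - d ^+ 2).
    by rewrite mulrBr ll; ring.
  case: cl eP => /= eP.
    have l0 : 0 <= l by rewrite -(pmulr_rge0 _ (_ : 0 < 2 * s)) ?ll ?subr_ge0 //; lra.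
    have dr : - rho <= d by nra.
    rewrite -subr_ge0 vv mulr_ge0 // -(pmulr_rge0 _ (_ : 0 < 2 * s)); last lra.
    rewrite PE; nra.
  have l0 : 0 < l by rewrite -(pmulr_rgt0 _ (_ : 0 < 2 * s)) ?ll ?subr_gt0 //; lra.
  have dr : - rho < d by nra.
  rewrite -subr_gt0 vv mulr_gt0 // -(pmulr_rgt0 _ (_ : 0 < 2 * s)); last lra.
  rewrite PE; nra.
rewrite /= subr0 enorm_lteif // => vP.
have := wbound v; set d := dotr w v => dv.
have vr : dotr v v <= rho ^+ 2 by apply: lteifW vP.
have sd : 0 <= s + d by nra.
(* Conversely [l] must solve [l^2 + 2 (s + d) l = rho^2 - |v|^2]; the larger root [q - (s + d)] is
   nonnegative, which keeps [e] in the ball because [rho^2 - |e|^2 = 2 s l]. *)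
pose q := Num.sqrt ((s + d) ^+ 2 + (rho ^+ 2 - dotr v v)).
have q0 : 0 <= q by exact: sqrtr_ge0.
have q2 : q ^+ 2 = (s + d) ^+ 2 + (rho ^+ 2 - dotr v v).
  by rewrite sqr_sqrtr // addr_ge0 ?sqr_ge0 ?subr_ge0.
pose l := q - (s + d); pose e := v + l *: w.
have ll : 2 * s * l = rho ^+ 2 - dotr e e.
  rewrite !dotrE ww (dotrC v w) -/d /l; nra.
exists (a + e); last by apply/rowP => i; apply: match_ ll; rewrite addrK.
rewrite addrC addKr enorm_lteif //.
case: cl vP => /= vP.
  have l0 : 0 <= l by rewrite subr_ge0; nra.
  by rewrite -subr_ge0 -ll; nra.
have l0 : 0 < l by rewrite subr_gt0; nra.
by rewrite -subr_gt0 -ll; nra.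
Qed.

(** Were the center at height less than [rho], its orthogonal projection onto the hyperplane would
    belong to the ball. *)
Lemma ball_halfspace_dist (R : realType) m (w a : 'rV[R]_m) c rho cl :
    dotr w w = 1 -> 0 < rho ->
    (forall x, enorm (x - a) < rho ?<= if cl -> c < dotr w x) ->
  rho <= dotr w a - c.
Proof.
move=> ww rho0 sub; rewrite leNgt; apply/negP => s_lt.
have nw : enorm w = 1 by rewrite /enorm ww sqrtr1.
have ca : c < dotr w a.
  apply: sub; rewrite subrr -(scale0r 0) enormZ normr0 mul0r.
  exact: lteifS.
have := sub (a - (dotr w a - c) *: w); rewrite addrC addKr enormN enormZ nw mulr1.
rewrite gtr0_norm ?subr_gt0 // !dotrE ww mulr1 subKr ltxx.
by move=> /(_ (lteifS cl s_lt)).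
Qed.

Lemma solid_ellipsoid_sqdist_map (R : realType) m (r : 'I_m -> 'rV[R]_m)
    w c cl B :
    aff_independent r -> w != 0 -> (forall i, dotr w (r i) = c) ->
    is_ball cl B -> (forall x, B x -> c < dotr w x) ->
  solid_ellipsoid cl (sqdist_map r @` B).
Proof.
move=> hr w0 wr [a [rho [rho0 ->]]] sub.
have nw : 0 < enorm w by rewrite sqrtr_gt0 dotr_gt0.
pose u := (enorm w)^-1 *: w.
have uu : dotr u u = 1 := dotr_normalize w0.
have ur i : dotr u (r i) = c / enorm w by rewrite dotrZl wr mulrC.
have ra : rho <= dotr u a - c / enorm w.
  apply: (@ball_halfspace_dist _ _ _ _ _ _ cl) => // x /sub wx.
  by rewrite dotrZl [c / _]mulrC ltr_pM2l ?invr_gt0.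
have ua : dotr u a != c / enorm w.
  by apply: contraTneq ra => ->; rewrite subrr -ltNge.
exists [set v | enorm (v - 0) < rho ?<= if cl]; split; first by exists 0, rho.
exists (2 *: offset_mx r a), (\row_i (dotr (a - r i) (a - r i) + rho ^+ 2)).
split; last exact: (sqdist_map_ball _ uu).
by rewrite unitmxZ ?unitfE ?pnatr_eq0 // (offset_mx_unit hr ur).
Qed.

(** * Separation of the images of disjoint balls *)

(** Otherwise the point dividing the segment of centers in the ratio [rho1 : rho2] is strictly
    inside both balls. *)
Lemma disjoint_balls_dist (R : realType) m (a1 a2 : 'rV[R]_m) rho1 rho2 cl1 cl2 :
    0 < rho1 -> 0 < rho2 ->
    [set x | enorm (x - a1) < rho1 ?<= if cl1] `&`
    [set x | enorm (x - a2) < rho2 ?<= if cl2] = set0 ->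
  rho1 + rho2 <= enorm (a2 - a1).
Proof.
move=> r1 r2 dis; rewrite leNgt; apply/negP => Dlt.
pose d := a2 - a1; pose t := rho1 / (rho1 + rho2).
have rr : 0 < rho1 + rho2 by rewrite addr_gt0.
suff : set0 (a1 + t *: d) by [].
rewrite -dis; split => /=; apply: lteifS.
  rewrite addrC addKr enormZ ger0_norm ?divr_ge0 // ?ltW //.
  by rewrite /t mulrAC ltr_pdivrMr // ltr_pM2l.
rewrite (_ : _ - a2 = (t - 1) *: d); last first.
  by rewrite scalerBl scale1r opprB [a1 + _]addrC -addrA.
have -> : t - 1 = - (rho2 / (rho1 + rho2)) by rewrite /t; field; rewrite gt_eqF.
rewrite scaleNr enormN enormZ ger0_norm ?divr_ge0 // ?ltW //.
by rewrite mulrAC ltr_pdivrMr // ltr_pM2l.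
Qed.

(* On the image of the map, the functional with coefficients [g] reads
   [|x - b|^2], up to a constant, where [b] has barycentric coordinates [g]. *)
Lemma separable_of_center (R : realType) k m (r : 'I_k -> 'rV[R]_m) b t
    (S1 S2 : set 'rV[R]_m) :
    aff_hull r b -> 0 <= t ->
    (forall x, S1 x -> enorm (x - b) <= t) ->
    (forall x, S2 x -> t <= enorm (x - b)) ->
  separable_by_hyperplane (sqdist_map r @` S1) (sqdist_map r @` S2).
Proof.
move=> [g [sg bE]] t0 le1 le2.
pose K := \sum_i g i * dotr (r i) (r i) - dotr b b.
have gE x : dotr (\row_i g i) (sqdist_map r x) = enorm (x - b) ^+ 2 + K.
  by rewrite dotr_sqdist_map sg -bE sqr_enorm /K !dotrE (dotrC b x); ring.
exists (\row_i g i), (t ^+ 2 + K); split.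
- apply: contra_eq_neq sg => /rowP g0; rewrite big1 1?eq_sym ?oner_eq0 // => i _.
  by have := g0 i; rewrite !mxE.
- by move=> _ [x /le1 xt <-]; rewrite gE lerD2r ler_pXn2r // nnegrE enorm_ge0.
- by move=> _ [x /le2 xt <-]; rewrite gE lerD2r ler_pXn2r // nnegrE enorm_ge0.
Qed.

(** Subtracting barycentric coordinates of [r i0] from those of [r i0 + d] gives weights of sum
    zero, whose linear form reads [-2 <x, d>] plus a constant; the sign reverses the two sides. *)
Lemma separable_of_direction (R : realType) k m (r : 'I_k -> 'rV[R]_m) i0 d t
    (S1 S2 : set 'rV[R]_m) :
    d != 0 -> aff_hull r (r i0 + d) ->
    (forall x, S1 x -> t <= dotr x d) -> (forall x, S2 x -> dotr x d <= t) ->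
  separable_by_hyperplane (sqdist_map r @` S1) (sqdist_map r @` S2).
Proof.
move=> d0 [g [sg gd]] le1 le2; have [e [se re]] := aff_hull_vertex r i0.
pose h i := g i - e i.
have sh : \sum_i h i = 0 by rewrite sumrB sg se subrr.
have hd : \sum_i h i *: r i = d.
  under eq_bigr do rewrite scalerBl.
  by rewrite sumrB -re -gd addrC addKr.
pose K := \sum_i h i * dotr (r i) (r i).
have hE x : dotr (\row_i h i) (sqdist_map r x) = - 2 * dotr x d + K.
  by rewrite dotr_sqdist_map sh hd -/K; ring.
exists (\row_i h i), (- 2 * t + K); split.
- apply: contraNneq d0 => /rowP h0; rewrite -hd big1 // => i _.
  by have := h0 i; rewrite !mxE => ->; rewrite scale0r.
- by move=> _ [x /le1 xt <-]; rewrite hE; lra.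
- by move=> _ [x /le2 xt <-]; rewrite hE; lra.
Qed.

Lemma separable_sym (R : realType) m (S1 S2 : set 'rV[R]_m) :
  separable_by_hyperplane S1 S2 -> separable_by_hyperplane S2 S1.
Proof.
case=> w [c [w0 le1 le2]]; exists (- w), (- c); rewrite oppr_eq0; split=> // y.
  by move=> /le2; rewrite dotrNl lerN2.
by move=> /le1; rewrite dotrNl lerN2.
Qed.

(* When [a1] is the center closer to the hyperplane, the separating sphere
   encloses [B1] and is internally tangent to it. *)
Lemma separable_balls (R : realType) n (r : 'I_n.+1 -> 'rV[R]_n.+1) w c
    cl1 cl2 B1 B2 :
    aff_hull r = [set x | dotr w x = c] ->
    is_ball cl1 B1 -> is_ball cl2 B2 -> B1 `&` B2 = set0 ->
    (forall x, B1 x -> c < dotr w x) -> (forall x, B2 x -> c < dotr w x) ->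
  separable_by_hyperplane (sqdist_map r @` B1) (sqdist_map r @` B2).
Proof.
move=> hE [a1 [rho1 [r1 ->]]] [a2 [rho2 [r2 ->]]].
have inb cl (a : 'rV[R]_n.+1) rho : 0 < rho ->
    [set x | enorm (x - a) < rho ?<= if cl] a.
  move=> rho0 /=; rewrite subrr -(scale0r 0) enormZ normr0 mul0r.
  exact: lteifS.
move=> dis /(_ _ (inb _ _ _ r1)) c1 /(_ _ (inb _ _ _ r2)) c2.
wlog le12 : cl1 cl2 a1 a2 rho1 rho2 r1 r2 dis c1 c2 / dotr w a1 <= dotr w a2.
  move=> W; have [/W|/ltW/W] := leP (dotr w a1) (dotr w a2); first exact.
  by rewrite setIC in dis => sep; apply/separable_sym/sep.
have D := disjoint_balls_dist r1 r2 dis.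
set d := a2 - a1 in D.
have in1 x : enorm (x - a1) < rho1 ?<= if cl1 -> enorm (x - a1) <= rho1.
  exact: lteifW.
have in2 x : enorm (x - a2) < rho2 ?<= if cl2 -> enorm (x - a2) <= rho2.
  exact: lteifW.
have a2E : a2 = a1 + d by rewrite addrC subrK.
have wd : dotr w a2 = dotr w a1 + dotr w d by rewrite a2E dotrDr.
move: le12; rewrite le_eqVlt => /orP[/eqP eq12|lt12].
  apply: separable_sym.
  (* At equal heights [d] is parallel to the hyperplane; the threshold is that of the hyperplane
     orthogonal to [d] and tangent to the first ball on the side of [a2]. *)
  apply: (@separable_of_direction _ _ _ _ 0 d (dotr a1 d + rho1 * enorm d)).
  - by apply: contraTneq D => ->; rewrite /enorm dotr0 sqrtr0 -ltNge addr_gt0.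
  - have := aff_hull_vertex r 0; rewrite !hE /= dotrDr => ->; lra.
  - move=> x /in2 xa; have := dotr_le_enorm (a2 - x) d.
    rewrite dotrDl dotrNl -enormN opprB {1}a2E dotrDl -sqr_enorm.
    by have := enorm_ge0 d; nra.
  - move=> x /in1 xa; have := dotr_le_enorm (x - a1) d.
    by rewrite dotrDl dotrNl; have := enorm_ge0 d; nra.
(* Chosen so that [a1 - k *: d], on the line of centers, has height [c]. *)
pose k := (dotr w a1 - c) / dotr w d.
have wd0 : 0 < dotr w d by lra.
have k0 : 0 <= k by rewrite divr_ge0 ?ltW // subr_gt0.
apply: (@separable_of_center _ _ _ _ (a1 - k *: d) (rho1 + k * enorm d)).
- rewrite hE /= dotrDr dotrNr dotrZr /k; field; exact: lt0r_neq0.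
- exact: addr_ge0 (ltW r1) (mulr_ge0 k0 (enorm_ge0 _)).
- move=> x /in1 xa; rewrite opprB addrCA addrC.
  apply: le_trans (ler_enormD _ _) _.
  by rewrite enormZ ger0_norm // lerD2r.
- move=> x /in2 xa.
  (* The center [a2] is at distance [(1 + k) |d|] from that of the sphere, so [x] is at distance at
     least [(1 + k) |d| - rho2], and [rho1 + rho2 <= |d|] concludes. *)
  have := ler_enormD (a2 - x) (x - (a1 - k *: d)).
  rewrite (_ : _ + _ = (1 + k) *: d); last first.
    by rewrite addrA subrK opprB addrCA scalerDl scale1r addrC.
  rewrite enormZ ger0_norm ?addr_ge0 //.
  by rewrite -[enorm (a2 - x)]enormN [- (a2 - x)]opprB; lra.
Qed.

Theorem theorem2 (R : realType) (n : nat) (r : 'I_n.+1 -> 'rV[R]_n.+1)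
    (hr : aff_independent r) :
  is_hyperplane (aff_hull r) /\
  solid_paraboloid (range (sqdist_map r)) /\
  forall Hm Hp : set 'rV[R]_n.+1, delimits (aff_hull r) Hm Hp ->
    (forall (cl : bool) (B : set 'rV[R]_n.+1), is_ball cl B ->
       B `<=` Hm \/ B `<=` Hp ->
       solid_ellipsoid cl (sqdist_map r @` B)) /\
    (forall (cl1 cl2 : bool) (B1 B2 : set 'rV[R]_n.+1),
       is_ball cl1 B1 -> is_ball cl2 B2 -> B1 `&` B2 = set0 ->
       (B1 `<=` Hm /\ B2 `<=` Hm) \/ (B1 `<=` Hp /\ B2 `<=` Hp) ->
       separable_by_hyperplane (sqdist_map r @` B1) (sqdist_map r @` B2)).
Proof.
have [w0 w0_neq0 w0r] := exists_normal r.
split; first by exists w0, (dotr w0 (r 0)); split=> //; exact: aff_hull_normal.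
split.
  apply: (solid_paraboloid_sqdist_map hr (dotr_normalize w0_neq0)) => i.
  by rewrite dotrZl w0r.
move=> Hm Hp [w [c [wn0 hE -> ->]]] {w0 w0_neq0 w0r}.
have wr i : dotr w (r i) = c by have := aff_hull_vertex r i; rewrite hE.
(* Passing to [(- w, - c)] turns the lower halfspace into an upper one, the only case treated
   above. *)
have wrN i : dotr (- w) (r i) = - c by rewrite dotrNl wr.
have hEN : aff_hull r = [set x | dotr (- w) x = - c].
  by rewrite hE; apply/seteqP; split=> x /=; rewrite dotrNl; [move->|move/oppr_inj].
have neg (B : set 'rV[R]_n.+1) : B `<=` [set x | dotr w x < c] ->
    forall x, B x -> - c < dotr (- w) x.
  by move=> sub x /sub; rewrite dotrNl ltrN2.
split.
  move=> cl B ballB [/neg sub|sub].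
    by apply: solid_ellipsoid_sqdist_map ballB sub; rewrite ?oppr_eq0.
  exact: solid_ellipsoid_sqdist_map ballB sub.
move=> cl1 cl2 B1 B2 b1 b2 dis [[/neg s1 /neg s2]|[s1 s2]].
  exact: separable_balls hEN b1 b2 dis s1 s2.
exact: separable_balls hE b1 b2 dis s1 s2.
Qed.
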